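(* Let $k$ be an integer with $1\le k\le N-1$ such that $\phi^{k-1}-\phi^k>\phi^k-\phi^{k+1}$, and suppose there exist a labeled atom ${\tt Z}\in\aleph_k^\bullet$ and forests $F,G\in\tilde{\cal F}^{k-1}$ such that ${\tt N}^{out}_{\tt Z}(F)\neq\emptyset$ and ${\tt N}^{out}_{\tt Z}(G)=\emptyset$. Then: 1) $F|_{\uparrow{\tt Z}}\in\tilde{\cal T}^\circ_{\tt Z}$, and for every $T\in\tilde{\cal T}^\circ_{\tt Z}$ there exists $Q\in\tilde{\cal F}^{k-1}$ with $Q|_{\uparrow{\tt Z}}=T$; 2) $G|_{\tt Z}\in\tilde{\cal T}^\bullet_{\tt Z}$, and for every $T\in\tilde{\cal T}^\bullet_{\tt Z}$ there exists $Q\in\tilde{\cal F}^{k-1}$ with $Q|_{\uparrow{\tt Z}}=Q|_{\tt Z}=T$.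
   Context: $V$ is a directed graph without loops on a finite vertex set ${\tt N}$, $|{\tt N}|=N$; each arc $(i,j)$ has a real weight $v_{ij}$; $V$ is assumed to have at least one spanning tree. An (entering) forest is a directed graph in which at most one arc leaves each vertex and there are no directed cycles; its components are trees, the root of a tree being its unique vertex with no outgoing arc. All forests and trees are subgraphs of $V$. For a subgraph $G$ and ${\tt D}\subseteq{\tt N}$, $\Upsilon^G_{\tt D}=\sum_{i\in{\tt D},(i,j)\in G}v_{ij}$ (heads may lie outside ${\tt D}$), $\Upsilon^G=\Upsilon^G_{\tt N}$. ${\cal F}^j$: spanning forests of $V$ with exactly $j$ trees; $\phi^j=\min_{F\in{\cal F}^j}\Upsilon^F$ ($\phi^j=\infty$ if ${\cal F}^j=\emptyset$; $\phi^0=\infty$); $\tilde{\cal F}^j$: forests in ${\cal F}^j$ of weight $\phi^j$. $\mathfrak{A}_k$: algebra of subsets of ${\tt N}$ generated by the vertex sets of all trees of all forests in $\tilde{\cal F}^k$; $\aleph_k$: its atoms (nonempty elements ${\tt A}$ with ${\tt A}\cap{\tt B}\in\{\emptyset,{\tt A}\}$ for all ${\tt B}\in\mathfrak{A}_k$); $\aleph_k^\bullet$: labeled atoms (containing a root of some tree of some $F\in\tilde{\cal F}^k$). For ${\tt D}\subseteq{\tt N}$: ${\cal T}^\bullet_{\tt D}$ is the set of trees with vertex set ${\tt D}$, $\lambda^\bullet_{\tt D}=\min_{T\in{\cal T}^\bullet_{\tt D}}\Upsilon^T$, $\tilde{\cal T}^\bullet_{\tt D}=\{T\in{\cal T}^\bullet_{\tt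 D}:\Upsilon^T=\lambda^\bullet_{\tt D}\}$; ${\cal T}^\circ_{\tt D}$ is the set of trees $T$ with $|{\tt V}T|=|{\tt D}|+1$, ${\tt D}\subset{\tt V}T$, and $T|_{\tt D}\in{\cal T}^\bullet_{\tt D}$; $\lambda^\circ_{\tt D}=\min_{T\in{\cal T}^\circ_{\tt D}}\Upsilon^T$, $\tilde{\cal T}^\circ_{\tt D}=\{T\in{\cal T}^\circ_{\tt D}:\Upsilon^T=\lambda^\circ_{\tt D}\}$. $G|_{\tt D}$ is the induced subgraph on ${\tt D}$. ${\tt N}^{out}_{\tt D}(G)$ is the set of heads $j\notin{\tt D}$ of arcs $(i,j)\in G$ with $i\in{\tt D}$. The outgoing restriction $G|_{\uparrow{\tt D}}$ has as arcs exactly the arcs of $G$ with tail in ${\tt D}$ and vertex set ${\tt D}\cup{\tt N}^{out}_{\tt D}(G)$.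
   Formalization: The trees in T°_D are additionally required to have their root outside D (the extra vertex is the root); with the literal definition, which also admits the extra vertex as a leaf attached to D, claim 1 is false. *)

(* Defs.v *)
From HB Require Import structures.
From mathcomp Require Import all_boot all_order all_algebra.
From mathcomp Require Import reals constructive_ereal.

Set Implicit Arguments.
Unset Strict Implicit.
Unset Printing Implicit Defensive.

Import Order.TTheory GRing.Theory Num.Theory.
Local Open Scope ring_scope.

(* The ambient loopless digraph on all of N is a relation
   V : rel N, with weight v i j on the arc (i, j).  A digraph is a vertex set
   together with an arc set, so that isolated vertices matter; it is meaningful
   as a graph when [subgraph V G] holds. *)
Notation digraph N := ({set N} * {set N * N})%type.

Definition vset (N : finType) (G : digraph N) : {set N} := G.1.
Definition arcs (N : finType) (G : digraph N) : {set N * N} := G.2.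
Definition arc (N : finType) (G : digraph N) : rel N :=
  fun i j => (i, j) \in arcs G.

Definition subgraph (N : finType) (V : rel N) (G : digraph N) : bool :=
  [forall a in arcs G, [&& V a.1 a.2, a.1 \in vset G & a.2 \in vset G]].

Definition acyclic (N : finType) (G : digraph N) : bool :=
  [forall i, forall j, arc G i j ==> ~~ connect (arc G) j i].

Lemma acyclicP (N : finType) (G : digraph N) :
  reflect (forall s : seq N, cycle (arc G) s -> s = [::]) (acyclic G).
Proof.
apply: (iffP forallP) => [acG [|x p] //= | acG i].
  case: p => [|y p] /=.
    by rewrite andbT => xx; move/forallP: (acG x) => /(_ x); rewrite xx connect0.
  case/andP=> xy yp; move/forallP: (acG x) => /(_ y); rewrite xy /=.
  by case/negP; apply/connectP; exists (rcons p x); rewrite ?last_rcons.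
apply/forallP => j; apply/implyP => ij; apply/negP => /connectP [p jp lp].
by have := acG (j :: p); rewrite /= rcons_path jp -lp ij => /(_ isT).
Qed.

Definition forest (N : finType) (V : rel N) (G : digraph N) : bool :=
  [&& subgraph V G, [forall i, #|[set j | arc G i j]| <= 1]%N & acyclic G].

(* Vertex sets of the weakly connected components; for a forest these are the
   vertex sets of its trees. *)
Definition components (N : finType) (G : digraph N) : {set {set N}} :=
  equivalence_partition (connect (fun i j => arc G i j || arc G j i)) (vset G).

Definition tree (N : finType) (V : rel N) (T : digraph N) : bool :=
  forest V T && (#|components T| == 1)%N.

(* A component contains every arc leaving its vertices, so these are exactly
   the roots of the trees of a forest G. *)
Definition root_set (N : finType) (G : digraph N) : {set N} :=
  [set i in vset G | [forall j, ~~ arc G i j]].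

Definition weight (R : realType) (N : finType) (v : N -> N -> R)
    (G : digraph N) : R :=
  \sum_(a in arcs G) v a.1 a.2.

(* Minimum weight over a finite family, +oo for the empty family. *)
Definition min_weight (R : realType) (N : finType) (v : N -> N -> R)
    (X : {set digraph N}) : \bar R :=
  \big[Order.min/+oo%E]_(G in X) (weight v G)%:E.

Definition minimizers (R : realType) (N : finType) (v : N -> N -> R)
    (X : {set digraph N}) : {set digraph N} :=
  [set G in X | (weight v G)%:E == min_weight v X].

Definition spanning_forests (N : finType) (V : rel N) (j : nat)
    : {set digraph N} :=
  [set F | [&& forest V F, vset F == [set: N] & #|components F| == j]].

Definition phi (R : realType) (N : finType) (V : rel N) (v : N -> N -> R)
    (j : nat) : \bar R :=
  min_weight v (spanning_forests V j).

Definition min_forests (R : realType) (N : finType) (V : rel N)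
    (v : N -> N -> R) (j : nat) : {set digraph N} :=
  minimizers v (spanning_forests V j).

Definition set_algebra (N : finType) (S : {set {set N}}) : bool :=
  [&& set0 \in S, [forall A in S, ~: A \in S]
    & [forall A in S, forall B in S, A :|: B \in S]].

Definition generated_algebra (N : finType) (X : {set {set N}})
    : {set {set N}} :=
  \bigcap_(S : {set {set N}} | set_algebra S && (X \subset S)) S.

Definition algebra (R : realType) (N : finType) (V : rel N)
    (v : N -> N -> R) (k : nat) : {set {set N}} :=
  generated_algebra (\bigcup_(F in min_forests V v k) components F).

Definition atoms (R : realType) (N : finType) (V : rel N)
    (v : N -> N -> R) (k : nat) : {set {set N}} :=
  [set A in algebra V v k | (A != set0)
     && [forall B in algebra V v k, (A :&: B == set0) || (A :&: B == A)]].

Definition labeled_atoms (R : realType) (N : finType) (V : rel N)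
    (v : N -> N -> R) (k : nat) : {set {set N}} :=
  [set A in atoms V v k |
     [exists F in min_forests V v k, A :&: root_set F != set0]].

Definition induced (N : finType) (G : digraph N) (D : {set N}) : digraph N :=
  (vset G :&: D, [set a in arcs G | (a.1 \in D) && (a.2 \in D)]).

Definition out_nbrs (N : finType) (D : {set N}) (G : digraph N) : {set N} :=
  [set a.2 | a in arcs G & (a.1 \in D) && (a.2 \notin D)].

Definition outgoing (N : finType) (G : digraph N) (D : {set N}) : digraph N :=
  (D :|: out_nbrs D G, [set a in arcs G | a.1 \in D]).

Definition trees_on (N : finType) (V : rel N) (D : {set N})
    : {set digraph N} :=
  [set T | tree V T && (vset T == D)].

(* The extra vertex of T is its root: the single arc joining it to D leaves D.
   Without [disjoint root_set T & D] the extra vertex could also be a leaf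
   attached to a tree rooted in D, and such a T is never an outgoing
   restriction to D. *)
Definition trees_out_of (N : finType) (V : rel N) (D : {set N})
    : {set digraph N} :=
  [set T | [&& tree V T, #|vset T| == #|D|.+1, D \subset vset T,
               induced T D \in trees_on V D & [disjoint root_set T & D]]].

Definition min_trees_on (R : realType) (N : finType) (V : rel N)
    (v : N -> N -> R) (D : {set N}) : {set digraph N} :=
  minimizers v (trees_on V D).

Definition min_trees_out_of (R : realType) (N : finType) (V : rel N)
    (v : N -> N -> R) (D : {set N}) : {set digraph N} :=
  minimizers v (trees_out_of V D).

(* Main.v *)
(* An exchange argument.  Let [exch F G D] follow [G] on the tails in [D] and
   [F] elsewhere.  When [exch F G D] and [exch G F D] are both acyclic, they have
   the same total weight and the same total number of roots as [F] and [G].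
   Let [H], [P] be minimal with [k] roots and [D] a tree of [H].  If [D] held no
   root of [P], exchanging on [D] would give forests with [k - 1] and [k + 1]
   roots of total weight 2 phi^k, against the strict inequality; so [D] holds
   exactly one root of [P], and the exchanged forests are again minimal.  It
   follows that [Z] holds exactly one root of each minimal [H], and that no arc
   of [H] leaves [Z].
   Let now [F] be minimal with [k - 1] roots.  Exchanges with suitable [H] show
   that each tree of [H] holds at most one root of [F] and that, if [F] leaves
   [Z], it does so along a single arc and has no root in [Z], and otherwise it
   has exactly one root there.  So the arcs of [F] out of [Z] form a tree of the
   required shape.  Any other such tree can be put in its place, inside [F] if it
   stays in [Z], and else inside an [H] separating [Z] from its extra vertex; the
   result has [k - 1] roots, and comparing weights yields both claims. *)
Require Import Defs.
From HB Require Import structures.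
From mathcomp Require Import all_boot all_order all_algebra.
From mathcomp Require Import reals constructive_ereal.
From mathcomp Require Import zify lra.
(* Again, since [path.arc] would shadow [Defs.arc]. *)
Import Defs.

Set Implicit Arguments.
Unset Strict Implicit.
Unset Printing Implicit Defensive.

Import Order.TTheory GRing.Theory Num.Theory.

(** * Acyclic and functional relations *)

Section Relations.
Variable T : finType.
Implicit Types (e : rel T) (C : {set T}).

Definition acyclic_rel e := forall x y, e x y -> ~~ connect e y x.

Definition stable e C := forall x y, x \in C -> e x y -> y \in C.

Definition functional e := forall x y z, e x y -> e x z -> y = z.

Lemma connect_head e x y :
  connect e x y -> x = y \/ exists2 z, e x z & connect e z y.
Proof.
move=> /connectP[[|z p] /= ep ->]; first by left.
by case/andP: ep => xz zp; right; exists z => //; apply/connectP; exists p.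
Qed.

Lemma stable_connect e e' C : stable e C ->
    (forall x y, x \in C -> e x y -> e' x y) ->
  forall x y, x \in C -> connect e x y -> connect e' x y /\ y \in C.
Proof.
move=> stC sub x y xC /connectP[p ep ->] {y}.
elim: p x xC ep => [|z p IHp] x xC /=; first by rewrite connect0.
case/andP=> xz zp; have [zp' ?] := IHp z (stC _ _ xC xz) zp.
by split=> //; apply: connect_trans (connect1 (sub _ _ xC xz)) zp'.
Qed.

Lemma stable_last e C x y : stable e C -> x \in C -> connect e x y -> y \in C.
Proof. by move=> stC xC xy; have [] := stable_connect stC (fun _ _ _ H => H) xC xy. Qed.

(** A cycle cannot leave a stable set: it lies wholly inside [C], where its arcs belong to [e1], or
    wholly outside, where they belong to [e2]. *)
Lemma acyclic_split e e1 e2 C : stable e C ->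
    (forall x y, x \in C -> e x y -> e1 x y) ->
    (forall x y, x \notin C -> y \notin C -> e x y -> e2 x y) ->
  acyclic_rel e1 -> acyclic_rel e2 -> acyclic_rel e.
Proof.
move=> stC sub1 sub2 ac1 ac2 x y xy; apply/negP => yx.
have [xC | xC] := boolP (x \in C).
  have [yx1 _] := stable_connect stC sub1 (stC _ _ xC xy) yx.
  by move: (ac1 _ _ (sub1 _ _ xC xy)); rewrite yx1.
have out z : connect e z x -> z \notin C.
  by move=> zx; apply: contra xC => zC; apply: stable_last zx.
suff yx2 : connect e2 y x by move: (ac2 _ _ (sub2 _ _ xC (out _ yx) xy)); rewrite yx2.
have /connectP[p ep xE] := yx; elim: p y {xy yx} ep xE => [|z p IHp] y /=.
  by move=> _ ->; rewrite connect0.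
case/andP=> yz zp xE; have zx : connect e z x by apply/connectP; exists p.
have yx : connect e y x by apply: connect_trans (connect1 yz) zx.
exact: connect_trans (connect1 (sub2 _ _ (out _ yx) (out _ zx) yz)) (IHp _ zp xE).
Qed.

Lemma acyclic_sub e e' : subrel e e' -> acyclic_rel e' -> acyclic_rel e.
Proof.
move=> sub ac x y /sub /ac; apply: contra; apply: connect_sub.
by move=> a b /sub /connect1.
Qed.

Lemma functional_fork e x y z : functional e ->
  connect e x y -> connect e x z -> connect e y z \/ connect e z y.
Proof.
move=> fe /connectP[p ep ->] {y}; elim: p x ep => [|y p IHp] x /=; first by left.
case/andP=> xy yp xz; case: (connect_head xz) => [<- | [w xw wz]].
  by right; apply/connectP; exists (y :: p); rewrite //= xy.
by apply: IHp => //; rewrite (fe _ _ _ xy xw).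
Qed.

Definition sink e r := [forall y, ~~ e r y].

Lemma sinkP e r y : sink e r -> e r y = false.
Proof. by move/forallP/(_ y)/negbTE. Qed.

Lemma sink_connect e r y : sink e r -> connect e r y -> y = r.
Proof.
by move=> sr /connect_head[-> // | [z rz _]]; rewrite (sinkP _ sr) in rz.
Qed.

Lemma exists_sink e x : acyclic_rel e -> exists2 r, connect e x r & sink e r.
Proof.
move=> ac.
(* A vertex reachable from [x] with fewest reachable vertices is a sink: by acyclicity a successor
   would no longer reach it, hence would reach strictly fewer. *)
have [r xr rmin] := arg_minnP (fun z => #|connect e z|) (connect0 e x : connect e x x).
exists r => //; apply/forallP => y; apply/negP => ry.
have: #|connect e r| <= #|connect e y| by apply/rmin/(connect_trans xr)/connect1.
apply/negP; rewrite -ltnNge; apply/proper_card/properP; split.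
  by apply/subsetP => z; apply: connect_trans (connect1 ry).
by exists r; [apply: connect0 | apply: ac].
Qed.

(** In a forest this is the root of the tree containing [x]. The default [x] is never taken when [e]
    is acyclic. *)
Definition end_of e x := odflt x [pick r | connect e x r && sink e r].

Lemma end_ofP e x : acyclic_rel e -> connect e x (end_of e x) && sink e (end_of e x).
Proof.
move=> ac; rewrite /end_of; case: pickP => //= nosink.
by have [r xr sr] := exists_sink x ac; move: (nosink r); rewrite xr sr.
Qed.

Lemma end_of_sub e x r : functional e -> acyclic_rel e ->
  connect e x r -> sink e r -> end_of e x = r.
Proof.
move=> fe ac xr sr; have /andP[xe se] := end_ofP x ac.
case: (functional_fork fe xe xr) => [/(sink_connect se) | /(sink_connect sr)] //.
Qed.

Lemma end_of_connect e x y : functional e -> acyclic_rel e ->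
  connect e x y -> end_of e x = end_of e y.
Proof.
move=> fe ac xy; have /andP[ye se] := end_ofP y ac.
exact: end_of_sub (connect_trans xy ye) se.
Qed.

Lemma end_of_sink e r : functional e -> acyclic_rel e -> sink e r -> end_of e r = r.
Proof. by move=> fe ac; apply: end_of_sub. Qed.

(** Every arc preserves [end_of], and every vertex is joined to its end; so the weak components are
    the fibres of [end_of]. *)
Lemma connect_sym_end e x y : functional e -> acyclic_rel e ->
  connect (fun i j => e i j || e j i) x y = (end_of e x == end_of e y).
Proof.
move=> fe ac; apply/idP/eqP.
  case/connectP=> p ep ->{y}; elim: p x ep => //= z p IHp x /andP[xz /IHp <-].
  by case/orP: xz => /connect1 /(end_of_connect fe ac).
have half u : connect (fun i j => e i j || e j i) u (end_of e u).
  have /andP[ue _] := end_ofP u ac; apply: connect_sub ue => a b ab.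
  by apply: connect1; rewrite /= ab.
have sym : connect_sym (fun i j => e i j || e j i).
  by apply: sym_connect_sym => a b; rewrite orbC.
by move=> xy; apply: connect_trans (half x) _; rewrite xy sym; apply: half.
Qed.

End Relations.

(** * Forests and exchanges *)

Section Forests.
Variables (N : finType) (V : rel N).
Implicit Types (F G H T : digraph N) (D S Z : {set N}).

Lemma digraph_eq G H : vset G = vset H -> arcs G = arcs H -> G = H.
Proof. by case: G H => [? ?] [? ?] /= -> ->. Qed.

Lemma forestP G : reflect
  [/\ forall x y, arc G x y -> [&& V x y, x \in vset G & y \in vset G],
      functional (arc G) & acyclic_rel (arc G)] (forest V G).
Proof.
apply: (iffP and3P) => [[/forallP sub /forallP deg /forallP ac] | [sub fn ac]]; split.
- by move=> x y xy; move: (sub (x, y)); rewrite [_ \in _]xy.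
- move=> x y z xy xz; have /card_le1_eqP := deg x.
  by apply; rewrite inE.
- by move=> x y xy; have /forallP/(_ y) := ac x; rewrite xy.
- by apply/forallP => -[x y]; apply/implyP => /sub.
- apply/forallP => x; apply/card_le1_eqP => y z; rewrite !inE.
  by move=> xy xz; apply: (fn x).
- by apply/forallP => x; apply/forallP => y; apply/implyP => /ac.
Qed.

Lemma end_vset G x : forest V G -> x \in vset G -> end_of (arc G) x \in vset G.
Proof.
case/forestP => sub _ ac xG; have /andP[xe _] := end_ofP x ac.
by apply: stable_last xe => // a b _ /sub/and3P[].
Qed.

Lemma componentsE G : forest V G ->
  components G = [set [set y in vset G | end_of (arc G) x == end_of (arc G) y]
                 | x in vset G].
Proof.
case/forestP => _ fn ac; apply: eq_in_imset => x xG.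
by apply/setP => y; rewrite !inE connect_sym_end.
Qed.

(** Sending a root to its tree is a bijection, so trees can be counted by their roots, which are
    easier to follow under exchanges. *)
Lemma card_components G : forest V G -> #|components G| = #|root_set G|.
Proof.
move=> fG; have [sub fn ac] := forestP _ fG.
pose B r := [set y in vset G | r == end_of (arc G) y].
have injB : {in root_set G &, injective B}.
  move=> r s; rewrite !inE => /andP[rG sr] /andP[sG ss] /setP/(_ r).
  by rewrite !inE rG (end_of_sink fn ac sr) eqxx => /esym/eqP.
rewrite -(card_in_imset injB) componentsE //; congr #|pred_of_set _|.
apply/setP => A; apply/imsetP/imsetP => -[x xG ->].
  exists (end_of (arc G) x) => //; rewrite inE end_vset //.
  by have /andP[] := end_ofP x ac.
move: xG; rewrite inE => /andP[xG sx]; exists x => //.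
by rewrite (end_of_sink fn ac sx).
Qed.

Definition exch F G D : digraph N :=
  (vset F, [set a | if a.1 \in D then a \in arcs G else a \in arcs F]).

Lemma arc_exch F G D x y : arc (exch F G D) x y = if x \in D then arc G x y else arc F x y.
Proof. by rewrite /arc inE. Qed.

Lemma arc_exch_in F G D x y : x \in D -> arc (exch F G D) x y = arc G x y.
Proof. by rewrite arc_exch => ->. Qed.

Lemma arc_exch_out F G D x y : x \notin D -> arc (exch F G D) x y = arc F x y.
Proof. by rewrite arc_exch => /negbTE->. Qed.

Lemma forest_exch F G D : vset F = [set: N] -> forest V F -> forest V G ->
  acyclic_rel (arc (exch F G D)) -> forest V (exch F G D).
Proof.
move=> FT /forestP[subF fF _] /forestP[subG fG _] ac; apply/forestP; split=> //.
  move=> x y; rewrite arc_exch /= FT !inE !andbT.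
  by case: ifP => _; [case/subG/and3P | case/subF/and3P].
move=> x y z; rewrite !arc_exch.
by case: ifP => _; [apply: fG | apply: fF].
Qed.

Lemma sink_exch F G D x :
  sink (arc (exch F G D)) x = if x \in D then sink (arc G) x else sink (arc F) x.
Proof.
rewrite /sink; case: ifP => xD; apply: eq_forallb => y; rewrite arc_exch xD //.
Qed.

Lemma acyclic_exch_stable F G D : acyclic_rel (arc F) -> acyclic_rel (arc G) ->
  stable (arc G) D -> acyclic_rel (arc (exch F G D)).
Proof.
move=> aF aG stD; apply: (@acyclic_split _ _ (arc G) (arc F) D) => //.
- by move=> x y xD; rewrite arc_exch_in //; apply: stD.
- by move=> x y xD; rewrite arc_exch_in.
- by move=> x y xD _; rewrite arc_exch_out.
Qed.

(* Once a path of the exchanged graph leaves [S], it enters the complement of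
   [D], which [F] never leaves. *)
Lemma acyclic_exch_outward F G S D : acyclic_rel (arc F) -> acyclic_rel (arc G) ->
    stable (arc F) (~: D) -> S \subset D ->
    (forall x y, x \in S -> arc G x y -> (y \in S) || (y \notin D)) ->
  acyclic_rel (arc (exch F G S)).
Proof.
move=> aF aG stD /subsetP SD GS; set e := arc _.
have outS x : x \notin D -> x \notin S by apply: contra => /SD.
apply: (@acyclic_split _ _ (arc F)
  (fun x y => [&& e x y, x \in D & y \in D]) (~: D)) => //.
- move=> x y xD; rewrite /e arc_exch_out; first exact: stD.
  by apply: outS; rewrite inE in xD.
- move=> x y xD; rewrite /e arc_exch_out //.
  by apply: outS; rewrite inE in xD.
- by move=> x y; rewrite !inE !negbK => -> -> ->.
(* Once the relation is cut down to [D], the set [S] is stable: an arc of [G] from [S] that does not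
   leave [D] ends in [S]. *)
apply: (@acyclic_split _ _ (arc G) (arc F) S) => //.
- move=> x y xS /and3P[]; rewrite /e arc_exch_in // => xy _ yD.
  by have := GS _ _ xS xy; rewrite yD orbF.
- by move=> x y xS /and3P[]; rewrite /e arc_exch_in.
- by move=> x y xS _ /and3P[]; rewrite /e arc_exch_out.
Qed.

Definition sforests j F := [/\ forest V F, vset F = [set: N] & #|root_set F| = j].

Lemma spanning_forestsP j F : reflect (sforests j F) (F \in spanning_forests V j).
Proof.
rewrite inE; apply: (iffP and3P) => [[fF /eqP FT /eqP <-] | [fF FT <-]]; split => //.
- by rewrite card_components.
- exact/eqP.
- by rewrite card_components.
Qed.

Lemma root_set_exch F G D : D \subset vset F -> D \subset vset G ->
  root_set (exch F G D) = (root_set F :\: D) :|: (root_set G :&: D).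
Proof.
move=> /subsetP DF /subsetP DG; apply/setP => x.
rewrite !inE [[forall j, _]]sink_exch; have [xD|xD] := boolP (x \in D).
  by rewrite DF ?DG // andbT.
by rewrite andbF orbF.
Qed.

Lemma card_root_exch F G D : D \subset vset F -> D \subset vset G ->
  #|root_set (exch F G D)| + #|root_set F :&: D| = #|root_set F| + #|root_set G :&: D|.
Proof.
move=> DF DG; rewrite root_set_exch // cardsU.
rewrite (_ : (_ :\: D) :&: _ = set0) ?cards0 ?subn0; last first.
  by apply/setP => x; rewrite !inE; case: (x \in D); rewrite /= ?andbF.
have := cardsID D (root_set F); lia.
Qed.

(** The vertex set of the tree of [F] containing [x]. *)
Definition basin F x := [set y | end_of (arc F) y == end_of (arc F) x].

Lemma basin_id F x : x \in basin F x.
Proof. by rewrite inE. Qed.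

Lemma componentsP F D : forest V F -> vset F = [set: N] ->
  reflect (exists x, D = basin F x) (D \in components F).
Proof.
move=> fF FT; rewrite componentsE // FT.
have E x : [set y in [set: N] | end_of (arc F) x == end_of (arc F) y] = basin F x.
  by apply/setP => y; rewrite !inE eq_sym.
by apply: (iffP imsetP) => [[x _ ->] | [x ->]]; exists x; rewrite ?E.
Qed.

Lemma basin_component F x : forest V F -> vset F = [set: N] -> basin F x \in components F.
Proof. by move=> fF FT; apply/componentsP => //; exists x. Qed.

Lemma arc_basin F x y z : forest V F -> arc F y z -> (y \in basin F x) = (z \in basin F x).
Proof.
by case/forestP => _ fn ac /connect1 /(end_of_connect fn ac) E; rewrite !inE E.
Qed.

Lemma stable_basin F x : forest V F -> stable (arc F) (basin F x).
Proof. by move=> fF y z yD /(arc_basin x fF) <-. Qed.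

Lemma stable_basinC F x : forest V F -> stable (arc F) (~: basin F x).
Proof. by move=> fF y z yD /(arc_basin x fF) E; move: yD; rewrite !in_setC E. Qed.

Lemma end_root_set F x : forest V F -> x \in vset F -> end_of (arc F) x \in root_set F.
Proof.
move=> fF xF; rewrite inE end_vset //; have [_ _ ac] := forestP _ fF.
by have /andP[] := end_ofP x ac.
Qed.

Lemma end_basin F x : forest V F -> end_of (arc F) x \in basin F x.
Proof.
case/forestP => _ fn ac; have /andP[_ s] := end_ofP x ac.
by rewrite inE (end_of_sink fn ac s).
Qed.

Lemma root_basin F x q : forest V F -> q \in root_set F -> q \in basin F x ->
  q = end_of (arc F) x.
Proof.
case/forestP => _ fn ac; rewrite !inE => /andP[_ sq].
by rewrite (end_of_sink fn ac sq) => /eqP.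
Qed.

Lemma sum_card_components F (A : {set N}) : forest V F -> vset F = [set: N] ->
  \sum_(D in components F) #|A :&: D| = #|A|.
Proof.
move=> fF FT; have [_ fn ac] := forestP _ fF.
have part : partition (components F) [set: N].
  rewrite -FT; apply: equivalence_partitionP => x y z _ _ _.
  by rewrite !connect_sym_end //; split=> // /eqP ->.
transitivity (\sum_(x in [set: N] | x \in A) 1).
  rewrite (set_partition_big_cond _ part); apply: eq_bigr => D _.
  by rewrite -sum1_card; apply: eq_bigl => x; rewrite !inE andbC.
by rewrite -sum1_card; apply: eq_bigl => x; rewrite inE.
Qed.

End Forests.

(** * Minimal forests *)

(** The equality case of summing the inequalities [1 <= f i]. *)
Lemma sum_card_pos (I : finType) (A : {set I}) (f : I -> nat) :
    (forall i, i \in A -> 0 < f i) -> \sum_(i in A) f i = #|A| ->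
  forall i, i \in A -> f i = 1.
Proof.
move=> f_gt0 sumf i iA.
have [_] := @leqif_sum _ (mem A) (fun i => f i == 1) (fun=> 1) f
  (fun j jA => conj (f_gt0 j jA) (eq_sym _ _)).
by rewrite sum1_card sumf eqxx => /esym/forall_inP/(_ i iA)/eqP.
Qed.

(** * Weights under exchange, and minimizers *)

Section Weights.
Variables (R : realType) (N : finType) (v : N -> N -> R).
Implicit Types (F G : digraph N) (D : {set N}) (X : {set digraph N}).
Local Open Scope ring_scope.

Definition weight_from G D : R := \sum_(a in arcs G | a.1 \in D) v a.1 a.2.

Lemma weight_split G D : weight v G = weight_from G D + weight_from G (~: D).
Proof.
rewrite /weight (bigID (fun a => a.1 \in D)) /=; congr (_ + _).
by apply: eq_bigl => a; rewrite inE.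
Qed.

Lemma weight_exch F G D :
  weight v (exch F G D) = weight v F - weight_from F D + weight_from G D.
Proof.
have inD : weight_from (exch F G D) D = weight_from G D.
  by apply: eq_bigl => a; rewrite inE; case: (a.1 \in D); rewrite ?andbF.
have outD : weight_from (exch F G D) (~: D) = weight_from F (~: D).
  by apply: eq_bigl => a; rewrite !inE; case: (a.1 \in D); rewrite ?andbF.
by rewrite (weight_split (exch F G D) D) (weight_split F D) inD outD; lra.
Qed.

Lemma weight_swap F G D :
  weight v (exch F G D) + weight v (exch G F D) = weight v F + weight v G.
Proof. by rewrite !weight_exch; lra. Qed.

Lemma weight_outgoing G D : weight v (outgoing G D) = weight_from G D.
Proof. by apply: eq_bigl => a; rewrite inE. Qed.

Lemma weight_from_tails G D : (forall x y, arc G x y -> x \in D) ->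
  weight_from G D = weight v G.
Proof.
move=> tailD; apply: eq_bigl => -[x y].
by case: (boolP ((x, y) \in _)) => //= /tailD ->.
Qed.

Lemma min_weight_le G X : G \in X -> (min_weight v X <= (weight v G)%:E)%E.
Proof. exact: bigmin_le_cond. Qed.

Lemma minimizersP G X : reflect
  (G \in X /\ forall P, P \in X -> weight v G <= weight v P) (G \in minimizers v X).
Proof.
rewrite inE; apply: (iffP andP) => -[GX minG]; split=> //.
  by move=> P PX; rewrite -lee_fin (eqP minG) min_weight_le.
rewrite eq_le min_weight_le // andbT.
by apply/bigmin_geP; split=> [|P PX]; rewrite ?leey ?lee_fin ?minG.
Qed.

Lemma minimizers_weight G X : G \in minimizers v X -> min_weight v X = (weight v G)%:E.
Proof. by rewrite inE => /andP[_ /eqP]. Qed.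

Lemma minimizers_neq0 G X : G \in X -> exists H, H \in minimizers v X.
Proof.
move=> GX; have [H HX] := arg_minP (weight v) GX.
by exists H; apply/minimizersP.
Qed.

End Weights.

(** * Exchanges between minimal forests *)

Section MinForests.
Variables (R : realType) (N : finType) (V : rel N) (v : N -> N -> R) (m : nat).
Implicit Types (F G H P Q K T : digraph N) (D Z S : {set N}).
Local Notation w := (weight v).
Local Notation wD := (weight_from v).
Local Notation "F ~> x" := (end_of (arc F) x) (at level 40).

Definition min_forest j F := sforests V j F /\ forall P, sforests V j P -> (w F <= w P)%R.

Lemma min_forestsP j F : reflect (min_forest j F) (F \in min_forests V v j).
Proof.
apply: (iffP (minimizersP _ _ _)) => -[/spanning_forestsP sF minF]; split=> // P.
  by move/spanning_forestsP; apply: minF.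
by move/spanning_forestsP; apply: minF.
Qed.

(** The strict inequality between the [phi] values at [k = m.+1], put in terms of real weights. It
    is vacuous if there is no forest with [m] roots or none with [m.+2]. *)
Hypothesis strict : forall P Q H, sforests V m P -> sforests V m.+2 Q ->
  min_forest m.+1 H -> (w H + w H < w P + w Q)%R.

(** Neither new weight can fall below its minimum, and the total is the sum of both minima, so both
    minima are attained. *)
Lemma min_forest_swap a b F H F' H' : min_forest a F -> min_forest b H ->
    sforests V a F' -> sforests V b H' -> (w F' + w H' = w F + w H)%R ->
  min_forest a F' /\ min_forest b H'.
Proof.
move=> [_ minF] [_ minH] sF' sH' E; have := minF _ sF'; have := minH _ sH' => h1 h2.
split; split=> // P sP; [have := minF _ sP | have := minH _ sP]; lra.
Qed.

Lemma sforests_exch a c F T D : sforests V a F -> forest V T -> D \subset vset T ->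
    acyclic_rel (arc (exch F T D)) ->
    a + #|root_set T :&: D| = c + #|root_set F :&: D| ->
  sforests V c (exch F T D).
Proof.
case=> fF FT rF fT DT ac E; split=> //; first exact: forest_exch.
have := @card_root_exch _ F T D _ DT; rewrite FT subsetT => /(_ isT); lia.
Qed.

(** No arc of [H] enters or leaves its tree [D], so both exchanges are acyclic; the root counts
    follow because [H] has one root in [D]. *)
Lemma sforests_exch_basin a b c d H P x : sforests V a H -> sforests V b P ->
    let D := basin H x in
    a + #|root_set P :&: D| = c + 1 -> b + 1 = d + #|root_set P :&: D| ->
  sforests V c (exch H P D) /\ sforests V d (exch P H D).
Proof.
move=> sH sP D Ec Ed; have [fH HT rH] := sH; have [fP PT rP] := sP.
have [_ fnH acH] := forestP _ _ fH; have [_ fnP acP] := forestP _ _ fP.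
have HD1 : #|root_set H :&: D| = 1.
  rewrite (_ : _ :&: _ = [set H ~> x]) ?cards1 //.
  apply/setP => q; rewrite in_setI in_set1; apply/andP/eqP => [[] | ->].
    exact: (root_basin fH).
  by rewrite (end_basin _ fH) (end_root_set fH) ?HT ?inE.
split; apply: sforests_exch => //; rewrite ?HT ?PT ?subsetT ?HD1 ?rH ?rP //.
  apply: (@acyclic_exch_outward _ _ _ _ D) => //; first exact: (stable_basinC fH).
  by move=> y z _ _; rewrite orbN.
by apply: acyclic_exch_stable => //; apply: (stable_basin fH).
Qed.

Lemma min_forest_basin_root H P x : min_forest m.+1 H -> min_forest m.+1 P ->
  #|root_set P :&: basin H x| = 1.
Proof.
move=> mH mP; have [[fH HT rH] _] := mH; have [[fP PT rP] _] := mP.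
apply: (@sum_card_pos _ (components H) (fun D => #|root_set P :&: D|)).
- move=> D /(componentsP _ fH HT)[y ->]; rewrite lt0n; apply/eqP => P0.
  have [] := @sforests_exch_basin m.+1 m.+1 m m.+2 H P y mH.1 mP.1; rewrite ?P0; try lia.
  (* Adding the strict inequalities for [H] and for [P] puts [w H + w P] strictly below the
     exchanged total, which equals it. *)
  move=> s1 s2; have h1 := strict s1 s2 mH; have h2 := strict s1 s2 mP.
  have := weight_swap v H P (basin H y); lra.
- by rewrite (sum_card_components _ fH HT) (card_components fH) rP rH.
- exact: (basin_component _ fH HT).
Qed.

Lemma basin_root_exists H P x : min_forest m.+1 H -> min_forest m.+1 P ->
  exists2 r, r \in root_set P & r \in basin H x.
Proof.
move=> mH mP; have /eqP/cards1P[r /setP/(_ r)] := min_forest_basin_root x mH mP.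
by rewrite set11 => /setIP[]; exists r.
Qed.

Lemma basin_root_unique H P x r s : min_forest m.+1 H -> min_forest m.+1 P ->
  r \in root_set P -> r \in basin H x -> s \in root_set P -> s \in basin H x -> r = s.
Proof.
move=> mH mP rP rD sP sD; apply: (@card_le1_eqP _ (root_set P :&: basin H x)).
- by rewrite min_forest_basin_root.
- exact/setIP.
- exact/setIP.
Qed.

Lemma min_forest_exch_basin H P x : min_forest m.+1 H -> min_forest m.+1 P ->
  min_forest m.+1 (exch H P (basin H x)) /\ min_forest m.+1 (exch P H (basin H x)).
Proof.
move=> mH mP.
have [|| s1 s2] := @sforests_exch_basin m.+1 m.+1 m.+1 m.+1 H P x mH.1 mP.1;
  rewrite ?min_forest_basin_root //.
exact: (min_forest_swap mH mP s1 s2 (weight_swap v _ _ _)).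
Qed.

(** No generator of the algebra separates [x] from [y]; atoms are classes of this relation. *)
Definition same_tree x y := forall K, min_forest m.+1 K -> K ~> x = K ~> y.

(* Exchanging on the tree of [q] moves only the root [q], to [g]; as every tree
   holds exactly one root both before and after, it holds both or neither. *)
Lemma same_tree_root H P q g : min_forest m.+1 H -> min_forest m.+1 P ->
    q \in root_set H -> g \in root_set P -> g \in basin H q -> same_tree q g.
Proof.
move=> mH mP qH gP gD K mK; have [[fH HT rH] _] := mH; have [[fP PT rP] _] := mP.
have [mE _] := min_forest_exch_basin q mH mP; set E := exch _ _ _ in mE.
have rE x : (x \in root_set E) = if x \in basin H q then x == g else x \in root_set H.
  rewrite root_set_exch ?HT ?PT ?subsetT // in_setU in_setD in_setI.
  case: (boolP (x \in basin H q)) => xD; rewrite ?andbF ?orbF ?andbT //=.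
  apply/idP/eqP => [xP | -> //]; exact: (basin_root_unique mH mP xP xD gP gD).
have [g' g'E g'K] := basin_root_exists q mK mE.
move: g'E; rewrite rE; case: ifP => [_ /eqP gg | g'D g'H].
  by move: g'K; rewrite gg inE => /eqP.
have g'q := basin_root_unique mK mH g'H g'K qH (basin_id _ _).
by rewrite g'q basin_id in g'D.
Qed.

(** An atom that meets a generator is contained in it. Conversely, the sets that do not separate [x]
    from [y] form an algebra; if it contains every generator, it contains [Z]. *)
Lemma atom_same_tree Z x y : Z \in atoms V v m.+1 -> x \in Z ->
  y \in Z <-> same_tree x y.
Proof.
rewrite inE => /and3P[ZA Z0 /forall_inP Zat] xZ; split=> [yZ K mK | sxy].
  have BA : basin K x \in algebra V v m.+1.
    apply/bigcapP => S /andP[_ /subsetP sub]; apply/sub/bigcupP; exists K.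
      exact/min_forestsP.
    by case: mK => -[fK KT _] _; apply: (basin_component _ fK KT).
  case/orP: (Zat _ BA) => /eqP/setP ZB.
    by have := ZB x; rewrite !inE xZ eqxx.
  by have := ZB y; rewrite !inE yZ => /eqP->.
suff ZS : Z \in [set B : {set N} | (x \in B) == (y \in B)].
  by move: ZS; rewrite inE xZ => /eqP<-.
move/bigcapP: ZA; apply; apply/andP; split.
  apply/and3P; split; first by rewrite !inE.
    by apply/forall_inP => B; rewrite !inE => /eqP->.
  apply/forall_inP => B; rewrite inE => /eqP xB; apply/forall_inP => C.
  by rewrite !inE xB => /eqP->.
apply/bigcupsP => K /min_forestsP mK; have [[fK KT _] _] := mK.
by apply/subsetP => B /(componentsP _ fK KT)[z ->]; rewrite !inE sxy.
Qed.

(** * Minimal forests with [m.+1] roots near a labeled atom *)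

Section Atom.
Variable Z : {set N}.
Hypothesis hZ : Z \in labeled_atoms V v m.+1.

Lemma labeled_atom_atom : Z \in atoms V v m.+1.
Proof. by move: hZ; rewrite inE => /andP[]. Qed.

Lemma atomP x y : x \in Z -> y \in Z <-> same_tree x y.
Proof. exact: (atom_same_tree _ labeled_atom_atom). Qed.

Lemma atom_separated x y : x \in Z -> y \notin Z ->
  exists2 K, min_forest m.+1 K & K ~> x != K ~> y.
Proof.
move=> xZ yZ.
case: (boolP [exists K in min_forests V v m.+1, K ~> x != K ~> y]).
  by case/exists_inP => K /min_forestsP mK sep; exists K.
move/exists_inPn => nosep; case/negP: yZ; apply/(atomP _ xZ) => K /min_forestsP mK.
by have := nosep K mK; rewrite negbK => /eqP.
Qed.

Lemma exists_minf : exists H, min_forest m.+1 H.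
Proof.
by move: hZ; rewrite inE => /andP[_ /exists_inP[H /min_forestsP mH _]]; exists H.
Qed.

(** The label only provides a root [q] of some [H0] in [Z]. The tree of [H0] at [q] holds a root of
    [H], which lies in the same atom by [same_tree_root]. *)
Lemma atom_root H : min_forest m.+1 H -> exists2 q, q \in root_set H & q \in Z.
Proof.
move=> mH; move: hZ; rewrite inE => /andP[_ /exists_inP[H0 /min_forestsP mH0]].
case/set0Pn => q /setIP[qZ qH0]; have [g gH gD] := basin_root_exists q mH0 mH.
by exists g => //; apply/(atomP _ qZ); exact: (same_tree_root mH0 mH qH0 gH gD).
Qed.

Lemma atom_sub_basin H x : min_forest m.+1 H -> x \in Z -> Z \subset basin H x.
Proof.
move=> mH xZ; apply/subsetP => y yZ.
by rewrite inE ((atomP y xZ).1 yZ H mH).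
Qed.

(* Otherwise some tree [D] of a minimal [K] contains [Z] but not [y]; then in
   [exch K H D] the vertex [x] leaves [D] through [y], whereas the root in [Z]
   stays in [D], although both lie in the same atom. *)
Lemma stable_atom H : min_forest m.+1 H -> stable (arc H) Z.
Proof.
move=> mH x y xZ xy; apply: contraT => yZ; exfalso.
have [K mK xKy] := atom_separated xZ yZ.
have [mP' _] := min_forest_exch_basin x mK mH.
have [q qH qZ] := atom_root mH; have [[fK KT _] _] := mK; have [[fH HT _] _] := mH.
set D := basin K x in mP'; set P := exch K H D in mP'.
have [[fP _ _] _] := mP'; have [_ fnP acP] := forestP _ _ fP.
have ZD : Z \subset D by apply: atom_sub_basin.
have qD := subsetP ZD _ qZ; have xD := subsetP ZD _ xZ.
have Pq : P ~> q = q.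
  apply: end_of_sink => //; rewrite sink_exch qD.
  by move: qH; rewrite inE => /andP[].
have Py : P ~> y = q.
  rewrite -Pq -((atomP q xZ).1 qZ P mP'); apply/esym/end_of_connect => //.
  by apply: connect1; rewrite arc_exch_in.
have yD : y \in ~: D by rewrite !inE eq_sym.
have stP : stable (arc P) (~: D).
  move=> a b; rewrite [a \in _]in_setC => aD; rewrite arc_exch_out //.
  by apply: (stable_basinC fK); rewrite in_setC.
have : P ~> y \in ~: D.
  by apply: stable_last stP yD _; have /andP[] := end_ofP y acP.
by rewrite Py in_setC qD.
Qed.

Lemma atom_root_card H : min_forest m.+1 H -> #|root_set H :&: Z| = 1.
Proof.
move=> mH; have [q qH qZ] := atom_root mH; have [[fH HT _] _] := mH.
apply/eqP/cards1P; exists q; apply/setP => r; rewrite !in_set1 in_setI.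
apply/andP/eqP => [[rH rZ] | -> //].
have D : Z \subset basin H q by apply: atom_sub_basin.
rewrite (root_basin (x := q) fH rH) ?(subsetP D) //.
by rewrite -(root_basin (x := q) fH qH) ?basin_id.
Qed.

End Atom.

(* [H] has more trees than [F] has roots, so some tree [D] of [H] is free of roots
   of [F]; [exch F H D] is then minimal with [m.+1] roots and agrees with [F]
   outside [D]. *)
Lemma basin_root_le1 F H x : min_forest m F -> min_forest m.+1 H ->
  #|root_set F :&: basin H x| <= 1.
Proof.
move=> mF mH; have [[fF FT rF] _] := mF; have [[fH HT rH] _] := mH.
have [D DH F0] : exists2 D, D \in components H & #|root_set F :&: D| = 0.
  have [/exists_inP[D DH /eqP F0]|/exists_inPn no0] :=
    boolP [exists D in components H, #|root_set F :&: D| == 0]; first by exists D.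
  have : \sum_(D in components H) 1 <= \sum_(D in components H) #|root_set F :&: D|.
    by apply: leq_sum => D /no0; rewrite lt0n.
  by rewrite sum1_card (sum_card_components _ fH HT) (card_components fH) rF rH ltnn.
have /(componentsP _ fH HT)[y Dy] := DH; rewrite Dy in F0.
have [] := @sforests_exch_basin m.+1 m m m.+1 H F y mH.1 mF.1; rewrite ?F0; try lia.
move=> s1 s2.
have [_ mE] : min_forest m (exch H F (basin H y)) /\
    min_forest m.+1 (exch F H (basin H y)).
  by apply: (min_forest_swap mF mH) => //; rewrite weight_swap addrC.
have [xy | xy] := boolP (x \in basin H y).
  rewrite (_ : basin H x = basin H y) ?F0 //.
  by apply/setP => z; move: xy; rewrite !inE => /eqP->.
(* The tree of [x] is disjoint from that of [y], so the roots of [F] in it survive in the exchanged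
   forest, which has just one root there. *)
rewrite -(min_forest_basin_root x mH mE); apply: subset_leq_card; apply/subsetP => r.
rewrite !in_setI root_set_exch ?HT ?FT ?subsetT // => /andP[rF' rx].
rewrite rx andbT in_setU in_setD rF' andbT; apply/orP; left.
by move: rx xy; rewrite !inE => /eqP ->.
Qed.

Lemma min_forest_exch_basin1 F H x : min_forest m F -> min_forest m.+1 H ->
  #|root_set F :&: basin H x| = 1 -> min_forest m.+1 (exch H F (basin H x)).
Proof.
move=> mF mH F1.
have [] := @sforests_exch_basin m.+1 m m.+1 m H F x mH.1 mF.1; rewrite ?F1 // => s1 s2.
by case: (min_forest_swap mH mF s1 s2 (weight_swap v _ _ _)).
Qed.

Lemma min_forest_exch_basin0 F H x : min_forest m F -> min_forest m.+1 H ->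
  #|root_set F :&: basin H x| = 0 -> min_forest m (exch H F (basin H x)).
Proof.
move=> mF mH F0.
have [] := @sforests_exch_basin m.+1 m m m.+1 H F x mH.1 mF.1; rewrite ?F0; try lia.
move=> s1 s2.
by case: (min_forest_swap mF mH s1 s2) => //; rewrite weight_swap addrC.
Qed.

(** * Arcs by which a minimal forest with [m] roots leaves the atom *)

Section Exits.
Variables (Z : {set N}) (F : digraph N).
Hypotheses (hZ : Z \in labeled_atoms V v m.+1) (mF : min_forest m F).

(** A root of [F] in the tree would be the only one there. Exchanging on that tree would then give a
    minimal forest with [m.+1] roots containing the arc from [x] to [y], against [stable_atom]. *)
Lemma exit_no_root x y H : x \in Z -> y \notin Z -> arc F x y -> min_forest m.+1 H ->
  root_set F :&: basin H x = set0.
Proof.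
move=> xZ yZ xy mH; apply/eqP; rewrite -cards_eq0.
have := basin_root_le1 x mF mH; case E: #|_| => [//|[|//]] _.
have mE := min_forest_exch_basin1 mF mH E.
case/negP: yZ; apply: (stable_atom hZ mE xZ).
by rewrite arc_exch_in // basin_id.
Qed.

(* Let [H] separate [x1] from [y1], [D] be the tree of [H] holding [x1], and [S]
   the vertices of [D] that reach [x1] along [F] inside [D].  Exchanging [H] and
   [exch H F D] on [S] produces a minimal forest with [m.+1] roots, whose arcs
   cannot leave [Z]; if [x2] were not in [S] it would keep an exit arc of [F]. *)
Lemma exit_connect x1 y1 x2 y2 : x1 \in Z -> y1 \notin Z -> arc F x1 y1 ->
  x2 \in Z -> y2 \notin Z -> arc F x2 y2 -> connect (arc F) x2 x1.
Proof.
move=> x1Z y1Z xy1 x2Z y2Z xy2.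
have [H mH sep] := atom_separated hZ x1Z y1Z.
have F0 := exit_no_root x1Z y1Z xy1 mH.
have [[fH HT rH] _] := mH; have [_ fnH acH] := forestP _ _ fH.
have [[fF FT rF] _] := mF; have [_ fnF acF] := forestP _ _ fF.
set D := basin H x1 in F0.
have mP : min_forest m (exch H F D) by apply: min_forest_exch_basin0; rewrite // F0 cards0.
set P := exch H F D in mP; have [[fP PT rP] _] := mP.
have [_ fnP acP] := forestP _ _ fP.
have ZD : Z \subset D by apply: atom_sub_basin.
have y1D : y1 \notin D by rewrite inE eq_sym.
pose e : rel N := fun a b => [&& arc F a b, a \in D & b \in D].
pose S := [set a in D | connect e a x1].
have SD : S \subset D by apply/subsetP => a; rewrite inE => /andP[].
have Sout a b : a \in S -> arc F a b -> (b \in S) || (b \notin D).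
  case/setIdP => aD /connect_head[-> | [c /and3P[ac _ cD] cx]] ab.
    by rewrite (fnF _ _ _ ab xy1) y1D orbT.
  by rewrite (fnF _ _ _ ab ac) inE cD cx.
have Sin a b : a \in D -> a \notin S -> arc F a b -> b \notin S.
  move=> aD aS ab; apply: contra aS => /setIdP[bD bx]; rewrite inE aD.
  by apply: connect_trans (connect1 _) bx; rewrite /e ab aD.
have x2D := subsetP ZD _ x2Z.
suff : x2 \in S.
  rewrite inE => /andP[_]; apply: connect_sub => a b /and3P[ab _ _].
  exact: connect1.
have acA : acyclic_rel (arc (exch H F S)).
  by apply: acyclic_exch_outward Sout => //; apply: (stable_basinC fH).
have SP a b : a \notin S -> arc P a b -> b \notin S.
  move=> aS; have [aD | aD] := boolP (a \in D).
    by rewrite arc_exch_in //; apply: Sin.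
  rewrite arc_exch_out // => ab; apply/negP => /(subsetP SD).
  by rewrite -(arc_basin _ fH ab) (negbTE aD).
have acB : acyclic_rel (arc (exch P H S)).
  (* [P] never enters [S], so a cycle would lie either outside [S], in [P], or inside [S], in
     [H]. *)
  apply: (@acyclic_split _ _ (arc P) (arc H) (~: S)) => // a b; rewrite ?in_setC.
  - by move=> aS; rewrite arc_exch_out //; apply: SP.
  - by move=> aS; rewrite arc_exch_out.
  - by rewrite negbK => aS _; rewrite arc_exch_in.
have FS0 : root_set F :&: S = set0.
  by apply/eqP; rewrite -subset0 -F0 setIS.
have PS0 : root_set P :&: S = set0.
  rewrite root_set_exch ?HT ?FT ?subsetT // setIUl -setIA (setIidPr SD) FS0 setU0.
  apply/setP => a; rewrite in_setI in_setD in_set0.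
  by case: (boolP (a \in S)) => [/(subsetP SD)->|]; rewrite ?andbF.
have wE : (w (exch H F S) + w (exch P H S) = w H + w P)%R.
  rewrite !weight_exch; suff -> : wD P S = wD F S by lra.
  apply: eq_bigl => a; case: (boolP (a.1 \in S)) => [aS|]; rewrite ?andbF // inE.
  by rewrite (subsetP SD).
(* The root of [H] in [D] decides which exchange has [m.+1] roots. If it lies in [S], this is
   [exch P H S], which keeps the exit at [x2] unless [x2] is in [S]. *)
have [qS | qS] := boolP [exists q in root_set H, q \in S].
  have HS1 : #|root_set H :&: S| = 1.
    case/exists_inP: qS => q qH qS; apply/eqP/cards1P; exists q; apply/setP => r.
    rewrite in_setI in_set1; apply/andP/eqP => [[rH' rS] | -> //].
    by rewrite (root_basin fH rH' (subsetP SD _ rS)) (root_basin fH qH (subsetP SD _ qS)).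
  have sA : sforests V m (exch H F S).
    by apply: (@sforests_exch m.+1);
      rewrite ?FT ?subsetT ?HS1 ?FS0 ?cards0 ?addn1 ?addn0 //; case: mH.
  have sB : sforests V m.+1 (exch P H S).
    by apply: (@sforests_exch m);
      rewrite ?HT ?subsetT ?HS1 ?PS0 ?cards0 ?addn1 ?addn0 //; case: mP.
  have [_ mB] : min_forest m (exch H F S) /\ min_forest m.+1 (exch P H S).
    by apply: (min_forest_swap mP mH) => //; rewrite wE addrC.
  apply: contraT => x2S; case/negP: y2Z; apply: (stable_atom hZ mB x2Z).
  by rewrite arc_exch_out // arc_exch_in.
(* Otherwise it is [exch H F S], which contains the exit at [x1]; this case is impossible. *)
have HS0 : root_set H :&: S = set0.
  apply/setP => q; rewrite in_setI in_set0; apply/negP => /andP[qH qS'].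
  by case/exists_inP: qS; exists q.
have sA : sforests V m.+1 (exch H F S).
  by apply: (@sforests_exch m.+1); rewrite ?FT ?subsetT ?HS0 ?FS0 ?cards0 //; case: mH.
have sB : sforests V m (exch P H S).
  by apply: (@sforests_exch m); rewrite ?HT ?subsetT ?HS0 ?PS0 ?cards0 //; case: mP.
have [mA _] := min_forest_swap mH mP sA sB wE.
case/negP: y1Z; apply: (stable_atom hZ mA x1Z); rewrite arc_exch_in //.
by rewrite inE (subsetP ZD) // connect0.
Qed.

(** The tails of two exits reach each other, so they coincide by acyclicity; the heads then agree
    because [F] is functional. *)
Lemma exit_unique x1 y1 x2 y2 : x1 \in Z -> y1 \notin Z -> arc F x1 y1 ->
  x2 \in Z -> y2 \notin Z -> arc F x2 y2 -> x1 = x2 /\ y1 = y2.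
Proof.
move=> x1Z y1Z xy1 x2Z y2Z xy2; have [[fF _ _] _] := mF.
have [_ fnF acF] := forestP _ _ fF.
have x12 := exit_connect x2Z y2Z xy2 x1Z y1Z xy1.
have x21 := exit_connect x1Z y1Z xy1 x2Z y2Z xy2.
case: (connect_head x12) => [E | [z x1z zx2]].
  by split=> //; apply: fnF xy1 _; rewrite E.
by move: (acF _ _ x1z); rewrite (connect_trans zx2 x21).
Qed.

End Exits.

End MinForests.

(** * Restrictions to an atom *)

Section Restrictions.
Variables (N : finType) (V : rel N).
Implicit Types (F G T : digraph N) (Z : {set N}).

Lemma forest_sub F G : forest V F ->
    (forall a b, arc G a b -> [&& arc F a b, a \in vset G & b \in vset G]) ->
  forest V G.
Proof.
case/forestP => sub fn ac GF; have GF' : subrel (arc G) (arc F).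
  by move=> a b /GF/and3P[].
apply/forestP; split; last exact: acyclic_sub ac.
  by move=> a b ab; case/and3P: (GF _ _ ab) => /sub/and3P[-> _ _] -> ->.
by move=> a b c /GF' ab /GF' ac'; apply: fn ab ac'.
Qed.

Lemma out_nbrsP Z G y :
  reflect (exists x, [/\ x \in Z, y \notin Z & arc G x y]) (y \in out_nbrs Z G).
Proof.
apply: (iffP imsetP) => [[[a b]] | [x [xZ yZ xy]]].
  by rewrite !inE /= => /and3P[ab aZ bZ] ->; exists a.
by exists (x, y); rewrite // !inE [_ \in _]xy xZ yZ.
Qed.

Lemma stable_out_nbrs Z G : out_nbrs Z G = set0 <-> stable (arc G) Z.
Proof.
split=> [out0 x y xZ xy | st].
  apply: contraT => yZ; have : y \in out_nbrs Z G by apply/out_nbrsP; exists x.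
  by rewrite out0 inE.
apply/setP => y; rewrite inE; apply/negP => /out_nbrsP[x [xZ yZ xy]].
by rewrite (st _ _ xZ xy) in yZ.
Qed.

Lemma arc_outgoing G Z x y : arc (outgoing G Z) x y = arc G x y && (x \in Z).
Proof. by rewrite /arc inE. Qed.

Lemma arc_induced G Z x y : arc (induced G Z) x y = [&& arc G x y, x \in Z & y \in Z].
Proof. by rewrite /arc inE. Qed.

Lemma forest_outgoing G Z : forest V G -> forest V (outgoing G Z).
Proof.
move=> fG; apply: (forest_sub fG) => a b; rewrite arc_outgoing => /andP[ab aZ].
rewrite ab !in_setU aZ; case: (boolP (b \in Z)) => //= bZ.
by apply/out_nbrsP; exists a.
Qed.

Lemma forest_induced G Z : forest V G -> forest V (induced G Z).
Proof.
move=> fG; have [sub _ _] := forestP _ _ fG; apply: (forest_sub fG) => a b.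
rewrite arc_induced => /and3P[ab aZ bZ]; rewrite ab !in_setI aZ bZ.
by case/and3P: (sub _ _ ab) => _ -> ->.
Qed.

Lemma outgoing_exch F T Z : (forall a b, arc T a b -> a \in Z) ->
  vset T = Z :|: out_nbrs Z T -> outgoing (exch F T Z) Z = T.
Proof.
move=> tailT vT; apply: digraph_eq.
  rewrite vT /=; congr (_ :|: _); apply/setP => y.
  by apply/out_nbrsP/out_nbrsP => -[x [xZ yZ]] xy; exists x; split;
    rewrite // ?arc_exch_in // in xy *.
apply/setP => -[a b]; rewrite !inE /=.
case: (boolP (a \in Z)) => aZ; rewrite ?andbT ?andbF //.
by apply/esym/negP => /tailT; apply/negP.
Qed.

Lemma trees_onP Z T : reflect
  [/\ forest V T, vset T = Z & #|root_set T| = 1] (T \in trees_on V Z).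
Proof.
rewrite inE /tree; apply: (iffP andP) => [[/andP[fT] + /eqP vT] | [fT vT rT]].
  by rewrite (card_components fT) => /eqP rT.
by rewrite fT (card_components fT) rT vT !eqxx.
Qed.

(** The single root avoids [Z], so it is the extra vertex [y]. The path from [z] to [y] must leave
    [Z], which it can do only by an arc to [y]; this makes [y] an out-neighbour. *)
Lemma trees_out_ofP Z T z : z \in Z -> T \in trees_out_of V Z ->
  exists y, [/\ forest V T, y \notin Z, vset T = Z :|: out_nbrs Z T,
    root_set T :&: Z = set0 &
    forall a b, arc T a b -> a \in Z /\ (b \in Z \/ b = y)].
Proof.
move=> zZ; rewrite inE => /and5P[/andP[fT cT] /eqP cardT ZT _ dis].
move: cT; rewrite (card_components fT) => /cards1P[y rT].
have [sub fn ac] := forestP _ _ fT.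
have : y \in root_set T by rewrite rT set11.
rewrite inE => /andP[yT sy].
have yZ : y \notin Z by move: dis; rewrite rT disjoints1.
have vT : vset T = y |: Z.
  apply/esym/eqP; rewrite eqEcard subUset sub1set yT ZT cardT cardsU1 yZ.
  by rewrite add1n leqnn.
have arcT a b : arc T a b -> a \in Z /\ (b \in Z \/ b = y).
  move=> ab; case/and3P: (sub _ _ ab) => _; rewrite vT !in_setU1.
  case/orP=> [/eqP ay | aZ]; first by rewrite ay (sinkP _ sy) in ab.
  by case/orP=> [/eqP -> | bZ]; split=> //; [right | left].
exists y; split=> //; last by rewrite setIC; apply/eqP; rewrite setI_eq0 disjoint_sym.
rewrite vT setUC; congr (_ :|: _); apply/esym/setP => b; rewrite in_set1.
apply/out_nbrsP/eqP => [[a [_ bZ /arcT[_ [bZ'|//]]]] | ->].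
  by rewrite bZ' in bZ.
have zy : connect (arc T) z y.
  have /andP[ze _] := end_ofP z ac.
  have : end_of (arc T) z \in root_set T by rewrite (end_root_set fT) // (subsetP ZT).
  by rewrite rT in_set1 => /eqP <-.
have [/exists_inP[a aZ ay]|/exists_inPn noarc] := boolP [exists a in Z, arc T a y].
  by exists a.
case/negP: yZ; apply: stable_last zZ zy => a c aZ ac'.
by case: (arcT _ _ ac') => _ [//|cE]; have := noarc _ aZ; rewrite -cE ac'.
Qed.

End Restrictions.

Section Strictness.
Variables (R : realType) (N : finType) (V : rel N) (v : N -> N -> R).

(** The forests [P], [Q] and [H] make all three values of [phi] finite, so the inequality can be
    read in the reals. *)
Lemma phi_lt_weight m P Q H :
    (phi V v m - phi V v m.+1 > phi V v m.+1 - phi V v m.+2)%E ->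
    sforests V m P -> sforests V m.+2 Q -> min_forest V v m.+1 H ->
  (weight v H + weight v H < weight v P + weight v Q)%R.
Proof.
move=> hphi /spanning_forestsP sP /spanning_forestsP sQ /min_forestsP mH.
have [P' mP] := minimizers_neq0 v sP; have [Q' mQ] := minimizers_neq0 v sQ.
move: hphi; rewrite /phi (minimizers_weight mH) (minimizers_weight mP).
rewrite (minimizers_weight mQ) -!EFinB lte_fin.
have /minimizersP[_ /(_ _ sP)] := mP; have /minimizersP[_ /(_ _ sQ)] := mQ; lra.
Qed.

End Strictness.

(** * Replacing the arcs that start in the atom *)

Section AtomRestrictions.
Variables (R : realType) (N : finType) (V : rel N) (v : N -> N -> R) (m : nat).
Implicit Types (F G H P Q K T : digraph N).
Local Notation w := (weight v).
Local Notation wD := (weight_from v).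
Local Notation min_forest := (min_forest V v).
Hypothesis strict : forall P Q H, sforests V m P -> sforests V m.+2 Q ->
  min_forest m.+1 H -> (w H + w H < w P + w Q)%R.
Variable Z : {set N}.
Hypothesis hZ : Z \in labeled_atoms V v m.+1.

(** [Z] is stable with exactly one root for both forests, so the arcs of one may replace those of
    the other there; minimality gives both inequalities. *)
Lemma min_forest_weight_atom H K : min_forest m.+1 H -> min_forest m.+1 K -> wD H Z = wD K Z.
Proof.
suff le P Q : min_forest m.+1 P -> min_forest m.+1 Q -> (wD P Z <= wD Q Z)%R.
  by move=> mH mK; apply: le_anti; rewrite !le.
move=> mP mQ; have [[fP PT _] minP] := mP; have [[fQ QT _] _] := mQ.
have [_ _ acP] := forestP _ _ fP; have [_ _ acQ] := forestP _ _ fQ.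
have : sforests V m.+1 (exch P Q Z).
  apply: (sforests_exch mP.1) => //; rewrite ?QT ?subsetT //.
    by apply: acyclic_exch_stable => //; apply: (stable_atom strict hZ mQ).
  by rewrite !(atom_root_card strict hZ).
move/minP; rewrite weight_exch; lra.
Qed.

(** In [H] the extra vertex [y] of [T] might lead back to [Z]. The host is therefore a [K]
    separating [Z] from [y]; its one root in [Z] disappears, and the weight is the same as for
    [H]. *)
Lemma outgoing_extension H T : min_forest m.+1 H -> T \in trees_out_of V Z ->
  exists Q, [/\ sforests V m Q, outgoing Q Z = T & (w Q = w H - wD H Z + w T)%R].
Proof.
move=> mH0 TZ; have [z _ zZ] := atom_root strict hZ mH0.
have [y [fT yZ vT rT arcT]] := trees_out_ofP zZ TZ.
have [K mK sep] := atom_separated hZ zZ yZ.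
have tailT a b : arc T a b -> a \in Z by case/arcT.
exists (exch K T Z); split; last first.
- rewrite weight_exch (weight_from_tails v tailT) (min_forest_weight_atom mK mH0).
  by have := mK.2 _ mH0.1; have := mH0.2 _ mK.1; lra.
- exact: outgoing_exch.
have [[fK KT _] _] := mK; have [_ _ acK] := forestP _ _ fK; have [_ _ acT] := forestP _ _ fT.
apply: (sforests_exch mK.1) => //; first by rewrite vT subsetUl.
  apply: (@acyclic_exch_outward _ _ _ _ (basin K z)) => //.
  - exact: (stable_basinC fK).
  - exact: (atom_sub_basin hZ mK zZ).
  - move=> a b _ /arcT[_ [-> // | ->]].
    by rewrite [_ \in basin _ _]inE eq_sym sep orbT.
by rewrite rT cards0 (atom_root_card strict hZ mK) addn0 addn1.
Qed.

(** * Minimal forests with [m] roots that leave the atom *)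

Section Leaving.
Variable F : digraph N.
Hypotheses (mF : min_forest m F) (hFout : out_nbrs Z F != set0).

Lemma leaving_no_root : root_set F :&: Z = set0.
Proof.
have [y /out_nbrsP[x [xZ yZ xy]]] := set0Pn _ hFout.
have [H mH] := exists_minf hZ.
apply/eqP; rewrite -subset0 -(exit_no_root strict hZ mF xZ yZ xy mH).
by exact: setIS (atom_sub_basin hZ mH xZ).
Qed.

(** There is one exit, from [x] to [y], and no root of [F] in [Z]. So [y] is the only root of the
    outgoing restriction and [x] the only root of its part induced on [Z]. *)
Lemma leaving_tree : outgoing F Z \in trees_out_of V Z.
Proof.
have [y /out_nbrsP[x [xZ yZ xy]]] := set0Pn _ hFout.
have [[fF FT _] _] := mF.
have outE : out_nbrs Z F = [set y].
  apply/setP => y'; rewrite in_set1; apply/out_nbrsP/eqP => [[x' [x'Z y'Z xy']] | ->].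
    by case: (exit_unique strict hZ mF xZ yZ xy x'Z y'Z xy').
  by exists x.
have arcF a : a \in Z -> exists b, arc F a b.
  move=> aZ; apply/existsP; apply: contraT; rewrite negb_exists => sa.
  by have := in_set0 a; rewrite -leaving_no_root !inE FT inE aZ sa.
have rF : root_set (outgoing F Z) = [set y].
  apply/setP => a; rewrite !inE outE in_set1; apply/andP/eqP => [[aV /forallP sa]|->].
    case/orP: aV => [aZ | /eqP //]; have [b ab] := arcF _ aZ.
    by have := sa b; rewrite arc_outgoing ab aZ.
  rewrite eqxx orbT; split=> //; apply/forallP => b.
  by rewrite arc_outgoing (negbTE yZ) andbF.
have fO : forest V (outgoing F Z) by apply: forest_outgoing.
rewrite inE /tree fO (card_components fO) rF cards1 eqxx /= outE setUC cardsU1 yZ eqxx.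
rewrite subsetUr disjoints1 yZ andbT /=; apply/trees_onP; split.
- exact: forest_induced.
- by rewrite /= outE setIC setIUr setIid (_ : _ :&: [set y] = set0) ?setU0 //;
    apply/eqP; rewrite setI_eq0 disjoint_sym disjoints1.
- apply/eqP/cards1P; exists x; apply/setP => a; rewrite in_set1 inE.
  apply/andP/eqP => [[/setIP[_ aZ] /forallP sa] | ->].
    have [b ab] := arcF _ aZ; have := sa b; rewrite arc_induced arc_outgoing ab aZ /=.
    by move=> bZ; case: (exit_unique strict hZ mF xZ yZ xy aZ bZ ab).
  split; first by rewrite !inE xZ.
  apply/forallP => b; rewrite arc_induced arc_outgoing xZ /= andbT.
  apply/negP => /andP[xb bZ]; have [_ fn _] := forestP _ _ fF.
  by rewrite (fn _ _ _ xy xb) bZ in yZ.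
Qed.

(** Putting the arcs of [H] on [Z] into [F] adds exactly one root, so the result competes with
    [H]. *)
Lemma leaving_weight H : min_forest m.+1 H -> (w H <= w F - wD F Z + wD H Z)%R.
Proof.
move=> mH; have [[fF FT rF] _] := mF; have [[fH HT _] minH] := mH.
have [_ _ acF] := forestP _ _ fF; have [_ _ acH] := forestP _ _ fH.
rewrite -weight_exch; apply: minH; apply: (sforests_exch mF.1) => //.
- by rewrite HT subsetT.
- by apply: acyclic_exch_stable => //; apply: (stable_atom strict hZ mH).
- by rewrite leaving_no_root cards0 (atom_root_card strict hZ mH) addn0 addn1.
Qed.

(** Put directly into [F], the tree [T] might close a cycle; the forest built from [H] still obeys
    the weight bound of a direct replacement. *)
Lemma leaving_extension T : T \in trees_out_of V Z ->
  exists Q, [/\ sforests V m Q, outgoing Q Z = T & (w Q <= w F - wD F Z + w T)%R].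
Proof.
have [H mH] := exists_minf hZ.
move=> /(outgoing_extension mH)[Q [sQ QT wQ]]; exists Q; split=> //.
by rewrite wQ; have := leaving_weight mH; lra.
Qed.

Lemma leaving_min : outgoing F Z \in min_trees_out_of V v Z.
Proof.
apply/minimizersP; split=> [|T /leaving_extension[Q [sQ _ wQ]]]; first exact: leaving_tree.
rewrite weight_outgoing; have := mF.2 _ sQ; lra.
Qed.

Lemma leaving_extension_min T : T \in min_trees_out_of V v Z ->
  exists2 Q, min_forest m Q & outgoing Q Z = T.
Proof.
case/minimizersP => TZ minT; have [Q [sQ QT wQ]] := leaving_extension TZ.
exists Q => //; split=> // P /mF.2; apply: le_trans.
by have := minT _ leaving_tree; rewrite weight_outgoing; lra.
Qed.

End Leaving.

(** * Minimal forests with [m] roots that stay in the atom *)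

Section Staying.
Variable G : digraph N.
Hypotheses (mG : min_forest m G) (stG : stable (arc G) Z).

(** At most one root, since [Z] lies in a single tree of [H]; at least one, since the path of [G]
    from [z] ends inside [Z]. *)
Lemma staying_root : #|root_set G :&: Z| = 1.
Proof.
have [H mH] := exists_minf hZ; have [z _ zZ] := atom_root strict hZ mH.
have [[fG GT _] _] := mG; have [_ _ acG] := forestP _ _ fG.
apply/eqP; rewrite eqn_leq; apply/andP; split.
  apply: leq_trans (basin_root_le1 strict z mG mH).
  exact: subset_leq_card (setIS _ (atom_sub_basin hZ mH zZ)).
apply/card_gt0P; exists (end_of (arc G) z); rewrite in_setI (end_root_set fG) ?GT //.
by apply: stable_last stG zZ _; have /andP[] := end_ofP z acG.
Qed.

Lemma induced_stable_outgoing : induced G Z = outgoing G Z.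
Proof.
have [[_ GT _] _] := mG; apply: digraph_eq.
  by rewrite /= GT setTI (stable_out_nbrs _ _).2 ?setU0.
apply/setP => -[a b]; rewrite !inE /=.
case: (boolP ((a, b) \in _)) => //= ab; apply: andb_idr => aZ; exact: stG ab.
Qed.

Lemma staying_tree : induced G Z \in trees_on V Z.
Proof.
have [[fG GT _] _] := mG; apply/trees_onP; split; first exact: forest_induced.
  by rewrite /= GT setTI.
rewrite -staying_root; congr #|pred_of_set _|; apply/setP => a.
rewrite !inE GT inE /= andbC; case: (boolP (a \in Z)) => aZ; rewrite ?andbF ?andbT //.
apply: eq_forallb => b; rewrite arc_induced aZ /=; congr (~~ _).
by apply: andb_idr; apply: stG.
Qed.

(** Here [T] goes into [G] itself: [Z] is stable under [T], so no cycle arises, and one root in [Z]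
    replaces another. *)
Lemma staying_extension T : T \in trees_on V Z ->
  exists Q, [/\ sforests V m Q, outgoing Q Z = T, induced Q Z = T
              & (w Q = w G - w (induced G Z) + w T)%R].
Proof.
case/trees_onP => fT vT rT; have [sub _ acT] := forestP _ _ fT.
have [[fG GT _] _] := mG; have [_ _ acG] := forestP _ _ fG.
have stT : stable (arc T) Z by move=> a b _ /sub/and3P[]; rewrite vT.
have tailT a b : arc T a b -> a \in Z by case/sub/and3P; rewrite vT.
have rTZ : root_set T :&: Z = root_set T.
  by apply/setIidPl/subsetP => a; rewrite inE vT => /andP[].
exists (exch G T Z); split.
- apply: (sforests_exch mG.1) => //; first by rewrite vT.
    exact: acyclic_exch_stable.
  by rewrite rTZ rT staying_root.
- by apply: outgoing_exch => //; rewrite (stable_out_nbrs _ _).2 ?setU0.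
- apply: digraph_eq; first by rewrite /= GT setTI.
  apply/setP => -[a b]; rewrite !inE /=; case: (boolP (a \in Z)) => aZ /=.
    by case: (boolP ((a, b) \in _)) => //= ab; apply: stT ab.
  by rewrite andbF; apply/esym/negP => /tailT; apply/negP.
- by rewrite weight_exch induced_stable_outgoing weight_outgoing (weight_from_tails v tailT).
Qed.

Lemma staying_min : induced G Z \in min_trees_on V v Z.
Proof.
apply/minimizersP; split=> [|T /staying_extension[Q [sQ _ _ wQ]]]; first exact: staying_tree.
have := mG.2 _ sQ; lra.
Qed.

Lemma staying_extension_min T : T \in min_trees_on V v Z ->
  exists2 Q, min_forest m Q & outgoing Q Z = T /\ induced Q Z = T.
Proof.
case/minimizersP => TZ minT; have [Q [sQ QT QT' wQ]] := staying_extension TZ.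
exists Q => //; split=> // P /mG.2; apply: le_trans.
by have := minT _ staying_tree; lra.
Qed.

End Staying.
End AtomRestrictions.

Theorem theorem7 (R : realType) (N : finType) (V : rel N) (v : N -> N -> R)
    (V_loopless : irreflexive V)
    (V_spanning_tree : exists T : digraph N, T \in trees_on V [set: N])
    (k : nat) (hk : (1 <= k <= #|N| - 1)%N)
    (hphi : (phi V v k.-1 - phi V v k > phi V v k - phi V v k.+1)%E)
    (Z : {set N}) (hZ : Z \in labeled_atoms V v k)
    (F G : digraph N)
    (hF : F \in min_forests V v k.-1) (hG : G \in min_forests V v k.-1)
    (hFout : out_nbrs Z F != set0) (hGout : out_nbrs Z G = set0) :
  (outgoing F Z \in min_trees_out_of V v Z /\
   (forall T : digraph N, T \in min_trees_out_of V v Z ->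
      exists2 Q : digraph N, Q \in min_forests V v k.-1 & outgoing Q Z = T))
  /\
  (induced G Z \in min_trees_on V v Z /\
   (forall T : digraph N, T \in min_trees_on V v Z ->
      exists2 Q : digraph N, Q \in min_forests V v k.-1 &
        outgoing Q Z = T /\ induced Q Z = T)).
Proof.
case: k => [//|m] /= in hk hphi hZ hF hG *.
have strict P Q H := @phi_lt_weight _ _ _ _ m P Q H hphi.
move/min_forestsP: hF => mF; move/min_forestsP: hG => mG.
have stG := (stable_out_nbrs _ _).1 hGout.
split; split.
- exact: (leaving_min strict hZ mF hFout).
- move=> T /(leaving_extension_min strict hZ mF hFout)[Q mQ QT].
  by exists Q => //; apply/min_forestsP.
- exact: (staying_min strict hZ mG stG).
- move=> T /(staying_extension_min strict hZ mG stG)[Q mQ QT].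
  by exists Q => //; apply/min_forestsP.
Qed.
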